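(* Consider the clique-wise coupled problem of minimizing $F(\mathbf{x})+G(\mathbf{y})$ subject to $A_l x_{\mathcal{C}_l}+B_l y_l=c_l$ for all $l\in\mathcal{Q}_\mathcal{G}$, and let $(\mathbf{x}^k,\mathbf{y}^k,\mathbf{u}^k)_{k\ge 0}$ be generated by the CL-ADMM algorithm or by the CL-FLiP-ADMM algorithm (both described in the context), with parameters $\alpha_i>0$ ($i\in\mathcal{N}$) and $\beta_l,\gamma_l,\phi_l>0$ ($l\in\mathcal{Q}_\mathcal{G}$), from arbitrary initial values $x_i^0,y_l^0,u_l^0$. Assume: (a) for every $i\in\mathcal{N}$, $f_i:\mathbb{R}^d\to\mathbb{R}\cup\{+\infty\}$ is proper, closed and convex, and in the decomposition $f_i=f_i^1+f_i^2$ the function $f_i^1$ is proper, closed and convex and $f_i^2:\mathbb{R}^d\to\mathbb{R}$ is convex and differentiable with $L_{f_i^2}$-Lipschitz continuous gradient for some $L_{f_i^2}\ge 0$; (b) for every $l\in\mathcal{Q}_\mathcal{G}$, $g_l:\mathbb{R}^{q_l}\to\mathbb{R}\cup\{+\infty\}$ is proper, closed and convex, and in the decomposition $g_l=g_l^1+g_l^2$ the function $g_l^1$ is proper, closed and convex and $g_l^2:\mathbb{R}^{q_l}\to\mathbb{R}$ is convex and differentiable with $L_{g_l^2}$-Lipschitz continuous gradient for some $L_{g_l^2}\ge 0$; (c) the Lagrangian $\mathcal{L}$ has a saddle point. Assume moreover that for all $i\in\mathcal{N}$, all $l\in\mathcal{Q}_\mathcal{G}$, and some $\varepsilon_l\in(0,2-\phi_l)$,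 $$\alpha_i^{-1}\ \ge\ \sum_{l\in\mathcal{Q}_\mathcal{G}^i}\gamma_l\lambda_{\max}(A_l^\top A_l)+L_{f_i^2},$$ $$\beta_l^{-1}-\gamma_l\lambda_{\max}(B_l^\top B_l)\ \ge\ 0,$$ $$\gamma_l\Bigl(1-\frac{(1-\phi_l)^2}{2-\phi_l-\varepsilon_l}\Bigr)B_l^\top B_l+Q_l\ \succeq\ 3L_{g_l^2}I_{q_l},$$ where $Q_l=\beta_l^{-1}I_{q_l}-\gamma_l B_l^\top B_l$. Then $$\lim_{k\to\infty}\bigl(F(\mathbf{x}^k)+G(\mathbf{y}^k)\bigr)=F(\mathbf{x}^* )+G(\mathbf{y}^* ),\qquad \lim_{k\to\infty}\bigl(\mathbf{A}\mathbf{W}\mathbf{x}^k+\mathbf{B}\mathbf{y}^k-\mathbf{c}\bigr)=0,$$ where $(\mathbf{x}^*,\mathbf{y}^*,\mathbf{u}^* )$ is a saddle point of $\mathcal{L}$.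
   Context: Graph. $\mathcal{G}=(\mathcal{N},\mathcal{E})$ is an undirected graph with $\mathcal{N}=\{1,\dots,n\}$. A set $\mathcal{C}\subset\mathcal{N}$ is a clique if the induced subgraph on $\mathcal{C}$ is complete (single nodes and edges are cliques; cliques need not be maximal). $\bar{\mathcal{Q}}_\mathcal{G}=\{1,\dots,q\}$ indexes all cliques $\mathcal{C}_1,\dots,\mathcal{C}_q$ of $\mathcal{G}$; $\mathcal{Q}_\mathcal{G}\subset\bar{\mathcal{Q}}_\mathcal{G}$ is a fixed subset; $\mathcal{Q}_\mathcal{G}^i=\{l\in\mathcal{Q}_\mathcal{G}: i\in\mathcal{C}_l\}$. Notation. For $\mathbf{x}=[x_1^\top,\dots,x_n^\top]^\top\in\mathbb{R}^{nd}$ with $x_i\in\mathbb{R}^d$, and $\mathcal{C}=\{j_1<\dots<j_{|\mathcal{C}|}\}$, $x_\mathcal{C}=[x_{j_1}^\top,\dots,x_{j_{|\mathcal{C}|}}^\top]^\top\in\mathbb{R}^{|\mathcal{C}|d}$. The bijection $\pi_l:\mathcal{C}_l\to\{1,\dots,|\mathcal{C}_l|\}$ sends the $j$-th smallest element of $\mathcal{C}_l$ to $j$. For a vector $v$ made of blocks in $\mathbb{R}^d$, $[v]_j\in\mathbb{R}^d$ is its $j$-th block. $\mathrm{prox}_{g}(x)=\arg\min_y\{g(y)+\frac12\|x-y\|^2\}$. $\lambda_{\max}$ is the largest eigenvalue; $\succeq$ is the Loewner order. Problem data. $A_l\in\mathbb{R}^{p_l\times|\mathcal{C}_l|d}$,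 $B_l\in\mathbb{R}^{p_l\times q_l}$, $c_l\in\mathbb{R}^{p_l}$ for $l\in\mathcal{Q}_\mathcal{G}$. $\mathbf{y}$, $\mathbf{u}$, $\mathbf{c}$ are the stacked vectors of $y_l\in\mathbb{R}^{q_l}$, $u_l\in\mathbb{R}^{p_l}$, $c_l$ over $l\in\mathcal{Q}_\mathcal{G}$; $F(\mathbf{x})=\sum_{i\in\mathcal{N}}f_i(x_i)$, $G(\mathbf{y})=\sum_{l\in\mathcal{Q}_\mathcal{G}}g_l(y_l)$; $\mathbf{A}$ and $\mathbf{B}$ are the block-diagonal matrices with diagonal blocks $A_l$ and $B_l$, $l\in\mathcal{Q}_\mathcal{G}$; $\mathbf{W}$ is obtained by stacking vertically the matrices $W_l$, $l\in\mathcal{Q}_\mathcal{G}$, where $W_l\mathbf{x}=x_{\mathcal{C}_l}$ for all $\mathbf{x}\in\mathbb{R}^{nd}$. Lagrangian: $\mathcal{L}(\mathbf{x},\mathbf{y},\mathbf{u})=F(\mathbf{x})+G(\mathbf{y})+\langle\mathbf{u},\mathbf{A}\mathbf{W}\mathbf{x}+\mathbf{B}\mathbf{y}-\mathbf{c}\rangle$; a saddle point minimizes over $(\mathbf{x},\mathbf{y})$ and maximizes over $\mathbf{u}$. CL-FLiP-ADMM algorithm. For $k=0,1,\dots$, for all $i\in\mathcal{N}$ and then all $l\in\mathcal{Q}_\mathcal{G}$: $$x_i^{k+1}=\mathrm{prox}_{\alpha_i f_i^1}\Bigl(x_i^k-\alpha_i\Bigl(\nabla f_i^2(x_i^k)+\sum_{l\in\mathcal{Q}_\mathcal{G}^i}\bigl[A_l^\top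 u_l^k+\gamma_l A_l^\top(A_l x_{\mathcal{C}_l}^k+B_l y_l^k-c_l)\bigr]_{\pi_l(i)}\Bigr)\Bigr),$$ $$y_l^{k+1}=\mathrm{prox}_{\beta_l g_l^1}\Bigl(y_l^k-\beta_l\bigl(\nabla g_l^2(y_l^k)+B_l^\top u_l^k+\gamma_l B_l^\top(A_l x_{\mathcal{C}_l}^{k+1}+B_l y_l^k-c_l)\bigr)\Bigr),$$ $$u_l^{k+1}=u_l^k+\phi_l\gamma_l(A_l x_{\mathcal{C}_l}^{k+1}+B_l y_l^{k+1}-c_l).$$ CL-ADMM algorithm. The special case $f_i^2=0$, $g_l^2=0$ of the CL-FLiP-ADMM algorithm, i.e. $f_i^1=f_i$, $g_l^1=g_l$ and $L_{f_i^2}=L_{g_l^2}=0$. Explicitly, for $k=0,1,\dots$, for all $i\in\mathcal{N}$ and then all $l\in\mathcal{Q}_\mathcal{G}$: $$x_i^{k+1}=\mathrm{prox}_{\alpha_i f_i}\Bigl(x_i^k-\alpha_i\sum_{l\in\mathcal{Q}_\mathcal{G}^i}\bigl[A_l^\top u_l^k+\gamma_l A_l^\top(A_l x_{\mathcal{C}_l}^k+B_l y_l^k-c_l)\bigr]_{\pi_l(i)}\Bigr),$$ $$y_l^{k+1}=\mathrm{prox}_{\beta_l g_l}\Bigl(y_l^k-\beta_l\bigl(B_l^\top u_l^k+\gamma_l B_l^\top(A_l x_{\mathcal{C}_l}^{k+1}+B_l y_l^k-c_l)\bigr)\Bigr),$$ $$u_l^{k+1}=u_l^k+\phi_l\gamma_l(A_l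 x_{\mathcal{C}_l}^{k+1}+B_l y_l^{k+1}-c_l).$$ *)

(* Defs.v *)
From HB Require Import structures.
From mathcomp Require Import all_boot all_order all_algebra.
From mathcomp Require Import all_classical all_reals all_analysis.

Set Implicit Arguments.
Unset Strict Implicit.
Unset Printing Implicit Defensive.

Import Order.TTheory GRing.Theory Num.Theory.
Import numFieldNormedType.Exports.

Local Open Scope classical_set_scope.
Local Open Scope ring_scope.

Section Euclidean.
Context {R : realType}.

(* The library norm on ['cV[R]_d] is the sup norm (same topology); [enorm] is
   the Euclidean one. *)
Definition inner d (u v : 'cV[R]_d) : R := (u^T *m v) 0 0.

Definition enorm d (v : 'cV[R]_d) : R := Num.sqrt (inner v v).

Definition proper_fun d (f : 'cV[R]_d -> \bar R) : Prop :=
  (forall x, f x <> -oo%E) /\ (exists x, f x <> +oo%E).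

Definition closed_fun d (f : 'cV[R]_d -> \bar R) : Prop :=
  closed [set p : 'cV[R]_d * R | (f p.1 <= p.2%:E)%E].

(* The endpoints t = 0, 1 are harmless since [0 * +oo = 0] in [\bar R]. *)
Definition convex_fun d (f : 'cV[R]_d -> \bar R) : Prop :=
  forall (t : R) (x y : 'cV[R]_d), 0 <= t <= 1 ->
    (f (t *: x + (1 - t) *: y)%R <= t%:E * f x + (1 - t)%:E * f y)%E.

Definition CCP d (f : 'cV[R]_d -> \bar R) : Prop :=
  [/\ proper_fun f, closed_fun f & convex_fun f].

Definition grad d (f : 'cV[R]_d -> R^o) (x : 'cV[R]_d) : 'cV[R]_d :=
  \col_j 'D_(delta_mx j 0) f x.

Definition convex_smooth d (L : R) (f : 'cV[R]_d -> R^o) : Prop :=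
  [/\ convex_function [set: convex_lmodType 'cV[R]_d] f,
      forall x, differentiable f x &
      forall x y, enorm (grad f x - grad f y) <= L * enorm (x - y)].

Definition argmin d (h : 'cV[R]_d -> \bar R) : set 'cV[R]_d :=
  [set y | forall z, (h y <= h z)%E].

(* For [g] proper, closed and convex this set is a singleton, and
   "z = prox_g(x)" is rendered [prox g x z]. *)
Definition prox d (g : 'cV[R]_d -> \bar R) (x : 'cV[R]_d) : set 'cV[R]_d :=
  argmin (fun y => g y + (2^-1 * enorm (x - y) ^+ 2)%:E)%E.

(* The spectrum of a real symmetric matrix is finite and, in positive dimension,
   nonempty, so the [sup] is attained; it is 0 in dimension 0. *)
Definition lambda_max d (M : 'M[R]_d) : R := sup [set a : R | eigenvalue M a].

Definition psd d (M : 'M[R]_d) : Prop :=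
  M^T = M /\ forall v : 'cV[R]_d, 0 <= inner v (M *m v).

Definition loewner_ge d (M N : 'M[R]_d) : Prop := psd (M - N).

End Euclidean.

(* Rectangular analogue of [\mxdiag]; [conform_mx 0 (M l)] is [M l], recast
   along [l = k]. *)
Definition blkdiag (R : pzRingType) m (p q : 'I_m -> nat)
    (M : forall l, 'M[R]_(p l, q l)) : 'M[R]_(\sum_l p l, \sum_l q l) :=
  \mxblock_(l, k) if l == k then conform_mx 0 (M l) else 0.

Lemma blkdiag_mxcol (R : pzRingType) m (p q : 'I_m -> nat) k
  (M : forall l, 'M[R]_(p l, q l)) (V : forall l, 'M[R]_(q l, k)) :
  blkdiag M *m \mxcol_l V l = \mxcol_l (M l *m V l).
Proof.
rewrite /blkdiag mul_mxblock_mxrow; apply/eq_mxcol => l.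
rewrite (bigD1 l) //= eqxx conform_mx_id big1 ?addr0 // => j.
by rewrite eq_sym => /negPf ->; rewrite mul0mx.
Qed.

Section Cliques.
Context {n : nat}.

Definition is_clique (e : rel 'I_n) (C : {set 'I_n}) : bool :=
  (C != finset.set0) &&
  [forall i in C, forall j in C, (i != j) ==> e i j].

Definition cliques (e : rel 'I_n) : {set {set 'I_n}} :=
  [set C | is_clique e C]%SET.

(* A family [Q] of cliques is indexed by ['I_#|Q|]. *)
Definition cl (Q : {set {set 'I_n}}) (l : 'I_#|Q|) : {set 'I_n} := enum_val l.

(* [enum C] is increasing, so [pos C i] is the (0-based) rank of [i] in [C],
   and [None] when [i] is not in [C]. *)
Definition pos (C : {set 'I_n}) (i : 'I_n) : option 'I_#|C| :=
  insub (index i (enum C)).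

Lemma pos_enum_val (C : {set 'I_n}) (j : 'I_#|C|) : pos C (enum_val j) = Some j.
Proof.
rewrite /pos (enum_val_nth (enum_val j)) index_uniq ?enum_uniq -?cardE //.
by rewrite valK.
Qed.

Lemma enum_val_mono (C : {set 'I_n}) (j k : 'I_#|C|) :
  (j < k)%N -> (enum_val j < enum_val k)%N.
Proof.
move=> jk; have [i0 i0E] : {i0 | i0 = enum_val j} by exists (enum_val j).
rewrite (enum_val_nth i0 j) (enum_val_nth i0 k).
have s : sorted (fun a b : 'I_n => (a < b)%N) (enum C).
  rewrite /enum_mem; apply: sorted_filter => [a b c|]; first exact: ltn_trans.
  by have := iota_ltn_sorted 0 n; rewrite -val_enum_ord sorted_map enumT.
apply: (sorted_ltn_nth _ _ s) => //; first by move=> a b c; exact: ltn_trans.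
- by rewrite inE -cardE.
- by rewrite inE -cardE.
Qed.

Context {R : realType} {d : nat}.

(* Stacked vectors are [\mxcol]s; [submxcol v j] is the [j]-th block. *)
Definition restr (C : {set 'I_n}) (x : 'cV[R]_(\sum_(i < n) d)) :
    'cV[R]_(\sum_(j < #|C|) d) :=
  \mxcol_j submxcol x (enum_val j).

(* The block [v]_(pi_C(i)), used only for [i \in C]. *)
Definition blk_at (C : {set 'I_n}) (v : 'cV[R]_(\sum_(j < #|C|) d)) (i : 'I_n) :
    'cV[R]_d :=
  oapp (fun j => submxcol v j) 0 (pos C i).

Definition Wl (C : {set 'I_n}) :
    'M[R]_(\sum_(j < #|C|) d, \sum_(i < n) d) :=
  \mxblock_(j < #|C|, i < n) ((if enum_val j == i then 1%:M else 0) : 'M[R]_d).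

Lemma WlE (C : {set 'I_n}) (x : 'cV[R]_(\sum_(i < n) d)) :
  Wl C *m x = restr C x.
Proof.
rewrite -[x in LHS]submxcolK /Wl mul_mxblock_mxrow /restr.
apply/eq_mxcol => j; rewrite (bigD1 (enum_val j)) //= eqxx mul1mx big1 ?addr0 //.
by move=> i; rewrite eq_sym => /negPf ->; rewrite mul0mx.
Qed.

Definition bigW (Q : {set {set 'I_n}}) :
    'M[R]_(\sum_(l < #|Q|) \sum_(j < #|cl l|) d, \sum_(i < n) d) :=
  \mxcol_l Wl (cl l).

Definition bigF (f : 'I_n -> 'cV[R]_d -> \bar R)
    (x : 'cV[R]_(\sum_(i < n) d)) : \bar R :=
  (\sum_(i < n) f i (submxcol x i))%E.

Definition bigG m (q : 'I_m -> nat) (g : forall l, 'cV[R]_(q l) -> \bar R)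
    (y : 'cV[R]_(\sum_l q l)) : \bar R :=
  (\sum_(l < m) g l (submxcol y l))%E.

Section Problem.
Context {Q : {set {set 'I_n}}} {p q : 'I_#|Q| -> nat}.
Context (A : forall l, 'M[R]_(p l, \sum_(j < #|cl l|) d))
        (B : forall l, 'M[R]_(p l, q l)) (c : forall l, 'cV[R]_(p l)).

Definition residual (x : 'cV[R]_(\sum_(i < n) d)) (y : 'cV[R]_(\sum_l q l)) :
    'cV[R]_(\sum_l p l) :=
  blkdiag A *m bigW Q *m x + blkdiag B *m y - \mxcol_l c l.

Definition residual_l l (x : 'cV[R]_(\sum_(i < n) d)) (y : 'cV[R]_(\sum_l q l)) :
    'cV[R]_(p l) :=
  A l *m restr (cl l) x + B l *m submxcol y l - c l.

Lemma residualE x y l : submxcol (residual x y) l = residual_l l x y.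
Proof.
have -> : residual x y = \mxcol_l residual_l l x y.
  rewrite /residual -mulmxA /bigW mxcol_mul -{1}[y]submxcolK !blkdiag_mxcol.
  by rewrite -mxcolD -mxcolB; apply/eq_mxcol => k; rewrite /residual_l WlE.
by rewrite mxcolK.
Qed.

Definition Lagrangian (f : 'I_n -> 'cV[R]_d -> \bar R)
    (g : forall l, 'cV[R]_(q l) -> \bar R)
    (x : 'cV[R]_(\sum_(i < n) d)) (y : 'cV[R]_(\sum_l q l))
    (u : 'cV[R]_(\sum_l p l)) : \bar R :=
  (bigF f x + bigG g y + (inner u (residual x y))%:E)%E.

Definition saddle_point (f : 'I_n -> 'cV[R]_d -> \bar R)
    (g : forall l, 'cV[R]_(q l) -> \bar R)
    (xs : 'cV[R]_(\sum_(i < n) d)) (ys : 'cV[R]_(\sum_l q l))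
    (us : 'cV[R]_(\sum_l p l)) : Prop :=
  (forall x y, (Lagrangian f g xs ys us <= Lagrangian f g x y us)%E) /\
  (forall u, (Lagrangian f g xs ys u <= Lagrangian f g xs ys us)%E).

Context (alpha : 'I_n -> R) (beta gamma phi : 'I_#|Q| -> R).

Definition CL_FLiP_ADMM
    (f1 : 'I_n -> 'cV[R]_d -> \bar R) (f2 : 'I_n -> 'cV[R]_d -> R)
    (g1 : forall l, 'cV[R]_(q l) -> \bar R) (g2 : forall l, 'cV[R]_(q l) -> R)
    (x : nat -> 'cV[R]_(\sum_(i < n) d)) (y : nat -> 'cV[R]_(\sum_l q l))
    (u : nat -> 'cV[R]_(\sum_l p l)) : Prop :=
  forall k,
  [/\ forall i,
        prox (fun z => (alpha i)%:E * f1 i z)%E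
          (submxcol (x k) i - alpha i *:
            (grad (f2 i) (submxcol (x k) i)
             + \sum_(l < #|Q| | i \in cl l)
                 blk_at ((A l)^T *m submxcol (u k) l
                         + gamma l *: ((A l)^T *m residual_l l (x k) (y k))) i))
          (submxcol (x k.+1) i),
      forall l,
        prox (fun z => (beta l)%:E * g1 l z)%E
          (submxcol (y k) l - beta l *:
            (grad (g2 l) (submxcol (y k) l) + (B l)^T *m submxcol (u k) l
             + gamma l *: ((B l)^T *m residual_l l (x k.+1) (y k))))
          (submxcol (y k.+1) l) &
      forall l,
        submxcol (u k.+1) l
        = submxcol (u k) l
          + (phi l * gamma l) *: residual_l l (x k.+1) (y k.+1)].

Definition CL_ADMM
    (f : 'I_n -> 'cV[R]_d -> \bar R) (g : forall l, 'cV[R]_(q l) -> \bar R)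
    (x : nat -> 'cV[R]_(\sum_(i < n) d)) (y : nat -> 'cV[R]_(\sum_l q l))
    (u : nat -> 'cV[R]_(\sum_l p l)) : Prop :=
  forall k,
  [/\ forall i,
        prox (fun z => (alpha i)%:E * f i z)%E
          (submxcol (x k) i - alpha i *:
            \sum_(l < #|Q| | i \in cl l)
              blk_at ((A l)^T *m submxcol (u k) l
                      + gamma l *: ((A l)^T *m residual_l l (x k) (y k))) i)
          (submxcol (x k.+1) i),
      forall l,
        prox (fun z => (beta l)%:E * g l z)%E
          (submxcol (y k) l - beta l *:
            ((B l)^T *m submxcol (u k) l
             + gamma l *: ((B l)^T *m residual_l l (x k.+1) (y k))))
          (submxcol (y k.+1) l) &
      forall l,
        submxcol (u k.+1) l
        = submxcol (u k) l
          + (phi l * gamma l) *: residual_l l (x k.+1) (y k.+1)].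

End Problem.
End Cliques.

(* Main.v *)
Require Import Defs.
From HB Require Import structures.
From mathcomp Require Import all_boot all_order all_algebra.
From mathcomp Require Import all_classical all_reals all_analysis.
From mathcomp Require Import ring lra.

Set Implicit Arguments.
Unset Strict Implicit.
Unset Printing Implicit Defensive.

Import Order.TTheory GRing.Theory Num.Theory.
Import numFieldNormedType.Exports.

Local Open Scope classical_set_scope.
Local Open Scope ring_scope.

(* Completing squares in the proximal optimality conditions rewrites the x-step in
   the metric 1/alpha - gamma A^T A and the y-step in the metric
   1/beta - gamma B^T B. Adding them, with the multiplier update, bounds the
   Lagrangian gap at (x^(k+1), y^(k+1), us) by the decrease of the squared
   distance to the saddle point (xs, ys, us), up to a cross term
   gamma <r^(k+1), B (y^(k+1) - y^k)>. Monotonicity of the subdifferential of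
   g^1 at two consecutive y-steps and Young's inequality with weight
   2 - phi - eps absorb it, at the price of adding multiples of |r^k|^2 and
   |y^k - y^(k-1)|^2 to the energy. The energy then decreases by at least the gap
   plus gamma eps / 2 |r|^2, so both tend to 0, and the objective error is the gap
   minus <us, r>. *)

(** * Euclidean inner product and Cauchy-Schwarz for semidefinite forms *)

Section InnerProduct.
Context {R : realType}.

Lemma innerE d (u v : 'cV[R]_d) : inner u v = \sum_i u i 0 * v i 0.
Proof. by rewrite /inner mxE; apply: eq_bigr => i _; rewrite mxE. Qed.

Lemma innerC d (u v : 'cV[R]_d) : inner u v = inner v u.
Proof. by rewrite !innerE; apply: eq_bigr => i _; rewrite mulrC. Qed.

Lemma innerDl d (u v w : 'cV[R]_d) : inner (u + v) w = inner u w + inner v w.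
Proof. by rewrite /inner linearD /= mulmxDl mxE. Qed.

Lemma innerNl d (u w : 'cV[R]_d) : inner (- u) w = - inner u w.
Proof. by rewrite /inner linearN /= mulNmx mxE. Qed.

Lemma innerZl d (a : R) (u w : 'cV[R]_d) : inner (a *: u) w = a * inner u w.
Proof. by rewrite /inner linearZ /= -scalemxAl mxE. Qed.

Lemma innerDr d (u v w : 'cV[R]_d) : inner w (u + v) = inner w u + inner w v.
Proof. by rewrite innerC innerDl !(innerC w). Qed.

Lemma innerNr d (u w : 'cV[R]_d) : inner w (- u) = - inner w u.
Proof. by rewrite innerC innerNl (innerC w). Qed.

Lemma innerZr d (a : R) (u w : 'cV[R]_d) : inner w (a *: u) = a * inner w u.
Proof. by rewrite innerC innerZl (innerC w). Qed.

Lemma inner0l d (w : 'cV[R]_d) : inner 0 w = 0.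
Proof. by rewrite -(scale0r w) innerZl mul0r. Qed.

Lemma inner0r d (w : 'cV[R]_d) : inner w 0 = 0.
Proof. by rewrite innerC inner0l. Qed.

Definition inner_lin :=
  (innerDl, innerDr, innerNl, innerNr, innerZl, innerZr).

Lemma inner_trmx m d (M : 'M[R]_(m, d)) u v :
  inner (M^T *m u) v = inner u (M *m v).
Proof. by rewrite /inner trmx_mul trmxK mulmxA. Qed.

Lemma inner_ge0 d (v : 'cV[R]_d) : 0 <= inner v v.
Proof. by rewrite innerE; apply: sumr_ge0 => i _; rewrite -expr2 sqr_ge0. Qed.

Lemma sqr_le_inner d (v : 'cV[R]_d) i j : v i j ^+ 2 <= inner v v.
Proof.
rewrite innerE (bigD1 i) //= (ord1 j) -expr2 lerDl.
by apply: sumr_ge0 => k _; rewrite -expr2 sqr_ge0.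
Qed.

Lemma inner_eq0 d (v : 'cV[R]_d) : inner v v = 0 -> v = 0.
Proof.
move=> v0; apply/matrixP => i j; rewrite mxE; apply/eqP; rewrite -sqrf_eq0.
by rewrite eq_le sqr_ge0 -v0 sqr_le_inner.
Qed.

Lemma inner_sum d (I : finType) (P : pred I) (v : I -> 'cV[R]_d) w :
  inner (\sum_(i | P i) v i) w = \sum_(i | P i) inner (v i) w.
Proof.
by apply: (big_morph (fun u => inner u w)) => [? ?|]; rewrite ?innerDl ?inner0l.
Qed.

Lemma inner_mxcol m (p : 'I_m -> nat) (u v : 'cV[R]_(\sum_i p i)) :
  inner u v = \sum_i inner (submxcol u i) (submxcol v i).
Proof.
rewrite /inner -{1}[u]submxcolK -{1}[v]submxcolK tr_mxcol mul_mxrow_mxcol.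
by rewrite summxE.
Qed.

Lemma enorm_ge0 d (v : 'cV[R]_d) : 0 <= enorm v.
Proof. exact: sqrtr_ge0. Qed.

Lemma sqr_enorm d (v : 'cV[R]_d) : enorm v ^+ 2 = inner v v.
Proof. by rewrite sqr_sqrtr // inner_ge0. Qed.

Lemma psd_cauchy_schwarz d (M : 'M[R]_d) u v : psd M ->
  inner u (M *m v) ^+ 2 <= inner u (M *m u) * inner v (M *m v).
Proof.
move=> [symM M0].
have sym : inner v (M *m u) = inner u (M *m v).
  by rewrite -inner_trmx symM innerC.
have q (t : R) : 0 <= inner u (M *m u) + 2 * t * inner u (M *m v)
                      + t ^+ 2 * inner v (M *m v).
  have := M0 (u + t *: v).
  by rewrite mulmxDr -scalemxAr !inner_lin sym => h; lra.
set a := inner u _ in q *; set b := inner u _ in q *.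
set c := inner v _ in q *.
have [c0|c0] := eqVneq c 0.
  have [->|b0] := eqVneq b 0; first by rewrite expr0n /= c0 mulr0.
  (* With [c = 0] the quadratic in [q] is affine in [t] and takes the value -1 here. *)
  have := q (- (a + 1) / (2 * b)).
  have -> : a + 2 * (- (a + 1) / (2 * b)) * b + (- (a + 1) / (2 * b)) ^+ 2 * c = -1.
    by rewrite c0; field.
  by rewrite ler0N1.
have c_gt0 : 0 < c by rewrite lt_def c0 M0.
(* The minimizer of the quadratic. *)
have := q (- b / c); have -> : a + 2 * (- b / c) * b + (- b / c) ^+ 2 * c
   = (a * c - b ^+ 2) / c by field.
by rewrite pmulr_lge0 ?invr_gt0 // subr_ge0.
Qed.

Lemma psd1 d : psd (1%:M : 'M[R]_d).
Proof. by split=> [|v]; rewrite ?trmx1 // mul1mx inner_ge0. Qed.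

Lemma sqr_cauchy_schwarz d (u v : 'cV[R]_d) :
  inner u v ^+ 2 <= inner u u * inner v v.
Proof. by have := psd_cauchy_schwarz u v (psd1 d); rewrite !mul1mx. Qed.

Lemma cauchy_schwarz d (u v : 'cV[R]_d) : inner u v <= enorm u * enorm v.
Proof.
apply: le_trans (ler_norm _) _.
by rewrite -sqrtr_sqr -sqrtrM ?inner_ge0 // ler_wsqrtr // sqr_cauchy_schwarz.
Qed.

End InnerProduct.

(** * The largest eigenvalue as a bound of the Rayleigh quotient *)

Section LambdaMax.
Context {R : realType}.

(** Cauchy-Schwarz on each row gives the squared Frobenius norm; adding 1 keeps the constant
    positive when [M = 0]. *)
Lemma inner_mulmx_bound m d (M : 'M[R]_(m, d)) :
  exists2 K, 0 < K & forall v, inner (M *m v) (M *m v) <= K * inner v v.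
Proof.
pose K := \sum_i inner (row i M)^T (row i M)^T.
have K0 : 0 <= K by apply: sumr_ge0 => i _; apply: inner_ge0.
exists (K + 1) => [|v]; first by lra.
apply: (@le_trans _ _ (K * inner v v)); last by have := inner_ge0 v; lra.
rewrite innerE mulr_suml; apply: ler_sum => i _; rewrite -expr2.
apply: le_trans (sqr_cauchy_schwarz _ _).
suff -> : (M *m v) i 0 = inner (row i M)^T v by [].
by rewrite mxE innerE; apply: eq_bigr => j _; rewrite !mxE.
Qed.

Lemma inner_gram m d (M : 'M[R]_(m, d)) v :
  inner v (M^T *m M *m v) = inner (M *m v) (M *m v).
Proof. by rewrite -mulmxA innerC inner_trmx. Qed.

Lemma psd_gram m d (M : 'M[R]_(m, d)) : psd (M^T *m M).
Proof.
split=> [|v]; first by rewrite trmx_mul trmxK.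
by rewrite inner_gram inner_ge0.
Qed.

(** With [w = N v], Cauchy-Schwarz for the form of [N] gives [|w|^4 <= <w, N w> <v, N v>], hence
    [|w|^2 <= (1 + H) <v, N v>]; invertibility bounds [|v|^2] by [K |w|^2]. *)
Lemma psd_unit_coercive d (N : 'M[R]_d) : psd N -> N \in unitmx ->
  exists2 k, 0 < k & forall v, k * inner v v <= inner v (N *m v).
Proof.
move=> psdN unitN.
have [K K0 hK] := inner_mulmx_bound (invmx N).
have [H H0 hH] := inner_mulmx_bound N.
exists (K * (1 + H))^-1 => [|v]; first by rewrite invr_gt0 mulr_gt0 // addr_gt0.
have v_le : inner v v <= K * inner (N *m v) (N *m v).
  by have := hK (N *m v); rewrite mulKmx.
set w := N *m v in v_le *.
rewrite mulrC ler_pdivrMr ?mulr_gt0 ?addr_gt0 // mulrCA.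
apply: le_trans v_le _; rewrite ler_pM2l //.
have vw0 : 0 <= inner v w by have [_] := psdN; exact.
have [w0|w_gt0] := leP (inner w w) 0.
  by apply: le_trans w0 _; rewrite mulr_ge0 // addr_ge0 // ltW.
rewrite -(ler_pM2l w_gt0) -expr2; apply: le_trans (psd_cauchy_schwarz w v psdN) _.
rewrite -/w [leRHS]mulrCA mulrC ler_wpM2l //.
have := inner_ge0 (w - N *m w); have := hH w.
have : 0 <= inner w (N *m w) by have [_] := psdN; exact.
by rewrite !inner_lin (innerC (N *m w) w); lra.
Qed.

(* With s the least bound of the Rayleigh quotient, s - M is positive
   semidefinite; were it invertible it would be coercive and s not least. Hence s
   is an eigenvalue of M. *)
Lemma lambda_maxP d (M : 'M[R]_d) v : psd M ->
  inner v (M *m v) <= lambda_max M * inner v v.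
Proof.
move=> psdM; have [symM M0] := psdM.
have [v0|vn0] := eqVneq (inner v v) 0.
  by rewrite (inner_eq0 v0) mulmx0 inner0l mulr0.
have [K K0 hK] := inner_mulmx_bound M.
pose S := [set a : R | forall v, inner v (M *m v) <= a * inner v v].
have S0 : S !=set0.
  exists (1 + K) => w; have := inner_ge0 (w - M *m w); have := hK w.
  by have := M0 w; rewrite !inner_lin (innerC (M *m w) w); lra.
have v_gt0 : 0 < inner v v by rewrite lt_def vn0 inner_ge0.
have lbS : has_lbound S.
  exists 0 => a /(_ v) /(le_trans (M0 v)).
  by rewrite pmulr_lge0.
have infS : S (inf S).
  move=> w; have [w0|wn0] := eqVneq (inner w w) 0.
    by rewrite (inner_eq0 w0) mulmx0 inner0l mulr0.
  have w_gt0 : 0 < inner w w by rewrite lt_def wn0 inner_ge0.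
  rewrite -ler_pdivrMr //; apply: lb_le_inf => // a aS.
  by rewrite ler_pdivrMr.
have psdN : psd ((inf S)%:M - M).
  split=> [|w]; first by rewrite linearB /= tr_scalar_mx symM.
  by rewrite mulmxBl mul_scalar_mx !inner_lin subr_ge0.
have ev : eigenvalue M (inf S).
  rewrite /eigenvalue /eigenspace kermx_eq0 row_free_unit.
  apply/negP => unitN.
  have {}unitN : (inf S)%:M - M \in unitmx.
    by rewrite -opprB -scaleN1r unitmxZ // unitrN1.
  have [k k0 hk] := psd_unit_coercive psdN unitN.
  have : S (inf S - k).
    move=> w; have := hk w.
    by rewrite mulmxBl mul_scalar_mx !inner_lin; lra.
  by move=> /(ge_inf lbS); lra.
apply: le_trans (infS v) _; rewrite ler_wpM2r ?inner_ge0 //.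
apply: ub_le_sup => //.
(* The spectrum must be bounded above for [sup] to dominate it. Eigenvectors are rows here; testing
   [infS] on their transposes gives [a <= inf S]. *)
exists (inf S) => a /eigenvalueP [r rM rn0].
have := infS r^T; rewrite -symM -trmx_mul rM linearZ /= innerZr.
rewrite ler_pM2r // lt_def inner_ge0 andbT; apply: contraNneq rn0.
by move=> /inner_eq0 /(congr1 trmx); rewrite trmxK trmx0 => ->.
Qed.

End LambdaMax.

(** * Convexity, smoothness and proximal points *)

Section ConvexAnalysis.
Context {R : realType}.

Lemma le0_of_le_sqr (a b : R) :
  (forall t : R, 0 < t <= 1 -> t * a <= t ^+ 2 * b) -> a <= 0.
Proof.
move=> ab; rewrite leNgt; apply/negP => a_gt0.
pose B : R := `|b| + 1; have B_gt0 : 0 < B by rewrite ltr_wpDl.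
have bB : b < B by rewrite ltr_pwDr // ler_norm.
have [t [t_gt0 t_le1 tE]] : exists t : R, [/\ 0 < t, t <= 1 & t * (a + B) = a].
  have aB : a + B != 0 by rewrite gt_eqF // addr_gt0.
  exists (a / (a + B)); split; last by rewrite divfK.
    by rewrite divr_gt0 // addr_gt0.
  by rewrite ler_pdivrMr; lra.
have /ab : 0 < t <= 1 by rewrite t_gt0.
by rewrite expr2 -mulrA ler_pM2l // -[leLHS]tE ler_pM2l //; lra.
Qed.

Lemma derive_inner_grad d (f : 'cV[R]_d -> R^o) x v :
  differentiable f x -> 'D_v f x = inner (grad f x) v.
Proof.
move=> df; rewrite deriveE // innerE.
have {1}-> : v = \sum_i v i 0 *: delta_mx i 0.
  by rewrite {1}[v]matrix_sum_delta; apply: eq_bigr => i _; rewrite big_ord1.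
rewrite linear_sum; apply: eq_bigr => i _.
by rewrite linearZ /= mxE deriveE // mulrC.
Qed.

Lemma convex_smooth_ge d L (f : 'cV[R]_d -> R^o) x y : convex_smooth L f ->
  f x + inner (grad f x) (y - x) <= f y.
Proof.
move=> [cvxf df _]; rewrite -derive_inner_grad // addrC -lerBrDr.
have := diff_derivable (v := y - x) (df x).
(* Convexity bounds the difference quotients by [f y - f x] only for [h] in ]0, 1], so the
   derivative is taken as a limit from the right. *)
rewrite /derivable /derive => cv; rewrite cvg_at_rightE //.
apply: limr_le; first exact: cvgP (cvg_dnbhs_at_right cv).
near=> h.
have h0 : 0 < h by near: h; exact: nbhs_right_gt.
have h1 : h <= 1 by near: h; exact: nbhs_right_le.
rewrite /= -[_ *: _]/(_ * _) mulrC ler_pdivrMr // lerBlDr.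
have := cvxf (Itv01 (ltW h0) h1) y x; rewrite !inE => /(_ I I).
rewrite convRE /= /unstable.onem -[conv _ _ _]/(h *: y + (1 - h) *: x).
have -> : h *: y + (1 - h) *: x = h *: (y - x) + x.
  by rewrite scalerBr scalerBl scale1r addrCA addrC.
by move=> /le_trans; apply; lra.
Unshelve. all: by end_near.
Qed.

(* Telescoping [convex_smooth_ge] over a uniform subdivision of [x, x + v] and
   letting the mesh tend to 0 avoids integrating the gradient. *)
Lemma smooth_descent d L (f : 'cV[R]_d -> R^o) x v : convex_smooth L f ->
  f (x + v) <= f x + inner (grad f x) v + L / 2 * inner v v.
Proof.
move=> smf; have [_ _ lip] := smf.
have step (h : R) j : 0 <= h ->
    f (x + (j%:R * h) *: v) <= f x + j%:R * h * inner (grad f x) v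
      + h ^+ 2 * (j%:R * (j%:R + 1)) * (L / 2 * inner v v).
  move=> h0; elim: j => [|j IH]; first by rewrite !mul0r mulr0 scale0r !mul0r !addr0.
  (* The gradient inequality is used at the far end [z] of the subinterval, so that it bounds [f z]
     from above. The slope there exceeds the one at [x] by at most [L * (j + 1) * h * |v|^2], and
     these excesses add up to the factor [j * (j + 1) / 2]. *)
  set z := x + (j.+1%:R * h) *: v.
  have := convex_smooth_ge z (x + (j%:R * h) *: v) smf.
  have -> : x + (j%:R * h) *: v - z = - h *: v.
    rewrite /z opprD addrACA subrr add0r -scalerBl; congr (_ *: _).
    by rewrite -natr1; ring.
  rewrite innerZr => h1.
  have : inner (grad f z - grad f x) v <= L * (j.+1%:R * h) * inner v v.
    apply: le_trans (cauchy_schwarz _ _) _.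
    have := lip z x; rewrite {2}/z addrAC subrr add0r => lz.
    apply: le_trans (ler_wpM2r (enorm_ge0 v) lz) _.
    rewrite /enorm innerZl innerZr mulrA -expr2 sqrtrM ?sqr_ge0 //.
    by rewrite sqrtr_sqr ger0_norm ?mulr_ge0 // -!mulrA -!expr2 sqr_sqrtr ?inner_ge0.
  rewrite innerDl innerNl -natr1 => h2.
  have := ler_wpM2l h0 h2; nra.
rewrite leNgt; apply/negP => gap.
set C := L / 2 * _ in gap step; set E := inner _ v in gap step.
pose D : R := f (x + v) - (f x + E + C).
have D0 : 0 < D by rewrite subr_gt0.
(* Ensures [C * h < D] for [h = 1 / (N + 1)]; the subdivided bound overshoots by exactly [C * h]. *)
have [N hN] : exists N : nat, C / D < N.+1%:R.
  exists (Num.truncn (C / D)); exact: truncnS_gt.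
have N0 : 0 < N.+1%:R :> R by rewrite ltr0n.
pose h : R := N.+1%:R^-1.
have h0 : 0 < h by rewrite invr_gt0.
have Nh : N.+1%:R * h = 1 by rewrite mulfV // gt_eqF.
have := step h N.+1 (ltW h0); rewrite Nh scale1r mul1r.
have -> : h ^+ 2 * (N.+1%:R * (N.+1%:R + 1)) = 1 + h.
  transitivity (N.+1%:R * h * (N.+1%:R * h) + N.+1%:R * h * h); first by ring.
  by rewrite Nh; ring.
rewrite ltr_pdivrMr // in hN.
have NDh : N.+1%:R * D * h = D by rewrite mulrAC Nh mul1r.
have : C * h < D by rewrite -NDh ltr_pM2r.
by rewrite /D; lra.
Qed.

(** The minimizer [y] is compared with the points [y + t (w - y)]: convexity bounds the change of
    [h] linearly in [t], the square adds a remainder in [t ^+ 2], and [le0_of_le_sqr] concludes. *)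
Lemma prox_ineq d (h : 'cV[R]_d -> \bar R) a x y : CCP h -> 0 < a ->
  prox (fun z => a%:E * h z)%E x y ->
  h y \is a fin_num /\
  forall w, h w \is a fin_num ->
    a * fine (h y) + inner (x - y) (w - y) <= a * fine (h w).
Proof.
move=> [[hNy [w0 hw0]] _ cvx] a0 pr.
have fin w : h w != +oo%E -> h w \is a fin_num.
  by move=> hw; rewrite fin_numE hw andbT; apply/eqP; exact: hNy.
have fy : h y \is a fin_num.
  apply/fin; apply/eqP => hy.
  have := pr w0; rewrite /= hy gt0_muley ?lte_fin // addye //.
  by rewrite -(fineK (fin _ (introN eqP hw0))) -EFinM -EFinD leye_eq.
split=> // w fw.
rewrite -subr_le0; apply: (@le0_of_le_sqr _ (2^-1 * inner (w - y) (w - y))).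
move=> t /andP[t0 t1].
have := cvx t w y; rewrite (ltW t0) t1 => /(_ isT).
set z := _ + _; rewrite -(fineK fw) -(fineK fy) -!EFinM -EFinD => hz.
have fz : h z \is a fin_num by apply/fin; apply/eqP => E; rewrite E leye_eq in hz.
have := pr z; rewrite /= -(fineK fy) -(fineK fz) -!EFinM -!EFinD lee_fin.
rewrite -(fineK fz) lee_fin in hz.
have -> : x - z = (x - y) - t *: (w - y).
  by apply/matrixP => i j; rewrite /z !mxE; ring.
have := ler_wpM2l (ltW a0) hz; move: (x - y) (w - y) => v r.
by rewrite !sqr_enorm !inner_lin (innerC r v); lra.
Qed.

End ConvexAnalysis.

(** * Inequalities for proximal gradient steps *)

Section ProxGradient.
Context {R : realType}.

(** Sum of [prox_ineq] for [h1], the gradient inequality for [h2] from [y] to [w], and the descent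
    inequality for [h2] from [y] to [y']. The gradients cancel; evaluating them at [y] costs the
    [L / 2] term. *)
Lemma prox_grad_ineq d (h h1 : 'cV[R]_d -> \bar R) (h2 : 'cV[R]_d -> R) L a y v y' :
    (forall z, h z = (h1 z + (h2 z)%:E)%E) -> CCP h1 -> convex_smooth L h2 ->
    0 < a -> prox (fun z => a%:E * h1 z)%E (y - a *: (grad h2 y + v)) y' ->
  h y' \is a fin_num /\
  forall w, h w \is a fin_num ->
    fine (h y') + inner (v + a^-1 *: (y' - y)) (y' - w)
    <= fine (h w) + L / 2 * inner (y' - y) (y' - y).
Proof.
move=> hE ccp1 sm2 a0 /(prox_ineq ccp1 a0) [f1y' ineq].
split=> [|w]; first by rewrite hE fin_numD f1y'.
rewrite !hE fin_numD andbT => f1w; rewrite !fineD //=.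
have := ineq _ f1w.
have := convex_smooth_ge y w sm2; have := smooth_descent y (y' - y) sm2.
rewrite subrKC.
set g := grad h2 y.
have -> : inner (y - a *: (g + v) - y') (w - y')
    = a * inner (a^-1 *: (y' - y) + g + v) (y' - w).
  rewrite -innerZl -(opprB y' w) innerNr -innerNl; congr inner.
  by apply/matrixP => i j; rewrite !mxE; field; rewrite gt_eqF.
rewrite -mulrDr ler_pM2l //.
have -> : w - y = (w - y') + (y' - y) by rewrite subrKA.
rewrite -(opprB w y'); move: (w - y') (y' - y) => r s.
by rewrite !inner_lin; lra.
Qed.

(** Each prox point is tested in the variational inequality of the other, so the values of [h1]
    cancel. The change of gradient is bounded by Lipschitz continuity and [2 r s <= r^2 + s^2]. *)
Lemma prox_grad_monotone d (h1 : 'cV[R]_d -> \bar R) (h2 : 'cV[R]_d -> R) L a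
    y0 v0 y1 v1 y2 :
    CCP h1 -> convex_smooth L h2 -> 0 <= L -> 0 < a ->
    prox (fun z => a%:E * h1 z)%E (y0 - a *: (grad h2 y0 + v0)) y1 ->
    prox (fun z => a%:E * h1 z)%E (y1 - a *: (grad h2 y1 + v1)) y2 ->
  inner (v1 - v0 + a^-1 *: ((y2 - y1) - (y1 - y0))) (y2 - y1)
  <= L / 2 * (inner (y1 - y0) (y1 - y0) + inner (y2 - y1) (y2 - y1)).
Proof.
move=> ccp1 [_ _ lip] L0 a0 /(prox_ineq ccp1 a0) [f1 ineq1].
move=> /(prox_ineq ccp1 a0) [f2 ineq2].
have := ineq1 _ f2; have := ineq2 _ f1.
set g0 := grad h2 y0; set g1 := grad h2 y1 => i2 i1.
have lg : inner (g0 - g1) (y2 - y1)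
    <= L / 2 * (inner (y1 - y0) (y1 - y0) + inner (y2 - y1) (y2 - y1)).
  apply: le_trans (cauchy_schwarz _ _) _.
  have -> : inner (y1 - y0) (y1 - y0) = enorm (y0 - y1) ^+ 2.
    by rewrite sqr_enorm -(opprB y1 y0) innerNl innerNr opprK.
  rewrite -sqr_enorm.
  move: (ler_wpM2r (enorm_ge0 (y2 - y1)) (lip y0 y1)).
  rewrite -/g0 -/g1; move: (enorm (y0 - y1)) (enorm (y2 - y1)) => r s /le_trans; apply.
  by have := mulr_ge0 L0 (sqr_ge0 (r - s)); lra.
suff : a * inner (g1 - g0 + (v1 - v0) + a^-1 *: ((y2 - y1) - (y1 - y0))) (y2 - y1) <= 0.
  rewrite pmulr_rle0 // => mono.
  apply: le_trans lg; move: mono; rewrite -(opprB g0 g1) -addrA.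
  by move: (g0 - g1) (_ + _ *: _) => r s; rewrite !inner_lin; lra.
have -> : a * inner (g1 - g0 + (v1 - v0) + a^-1 *: ((y2 - y1) - (y1 - y0))) (y2 - y1)
  = inner (y1 - a *: (g1 + v1) - y2) (y1 - y2) + inner (y0 - a *: (g0 + v0) - y1) (y2 - y1).
  rewrite -innerZl -(opprB y2 y1) innerNr -innerNl -innerDl; congr inner.
  by apply/matrixP => i j; rewrite !mxE; field; rewrite gt_eqF.
lra.
Qed.

End ProxGradient.

(** * Energy descent within one clique *)

Section BlockDescent.
Context {R : realType} {p q : nat}.
Context (B : 'M[R]_(p, q)) (beta gamma phi eps L : R).

(* Here a, v, y, y' stand for A_l(x^k - xs), u^k - us, y^k - ys and
   y^(k-1) - ys, so that a + B y is the residual. The negative terms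
   -gamma/2 |a|^2 and -gamma/2 |B(y - y')|^2 turn 1/alpha and 1/beta into the
   proximal metrics 1/alpha - gamma A^T A and 1/beta - gamma B^T B. *)
Definition block_energy (a v : 'cV[R]_p) (y y' : 'cV[R]_q) : R :=
  - (gamma / 2 * inner a a) + beta^-1 / 2 * inner y y
  + (2 * (phi * gamma))^-1 * inner v v
  + gamma * (2 - phi - eps) / 2 * inner (a + B *m y) (a + B *m y)
  + (beta^-1 + L) / 2 * inner (y - y') (y - y')
  - gamma / 2 * inner (B *m (y - y')) (B *m (y - y')).

(** [G] stands for the excess of [g] over its value at the saddle point. The inner product with [a2]
    and the square of [a2 - a1] are left to cancel against the x-step. The 3 in [3 * L] collects one
    [L / 2] each from the y-step, from monotonicity and from the new energy. *)
Lemma block_descent (a1 a2 u1 u2 us : 'cV[R]_p) (y0 y1 y2 : 'cV[R]_q) (G : R) :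
    0 < gamma -> 0 < phi -> 0 < eps < 2 - phi ->
    (forall z : 'cV[R]_q, 3 * L * inner z z <=
      gamma * (1 - (1 - phi) ^+ 2 / (2 - phi - eps)) * inner (B *m z) (B *m z)
      + (beta^-1 * inner z z - gamma * inner (B *m z) (B *m z))) ->
    G + inner (B^T *m u1 + gamma *: (B^T *m (a2 + B *m y1))
               + beta^-1 *: (y2 - y1)) y2 <= L / 2 * inner (y2 - y1) (y2 - y1) ->
    inner (B^T *m ((phi * gamma) *: (a1 + B *m y1))
           + gamma *: (B^T *m (a2 + B *m y1)) - gamma *: (B^T *m (a1 + B *m y0))
           + beta^-1 *: ((y2 - y1) - (y1 - y0))) (y2 - y1)
    <= L / 2 * (inner (y1 - y0) (y1 - y0) + inner (y2 - y1) (y2 - y1)) ->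
    u2 = u1 + (phi * gamma) *: (a2 + B *m y2) ->
    0 <= beta^-1 * inner (y2 - y1 - (y1 - y0)) (y2 - y1 - (y1 - y0))
         - gamma * inner (B *m (y2 - y1 - (y1 - y0))) (B *m (y2 - y1 - (y1 - y0))) ->
  G - inner (u1 + gamma *: (a1 + B *m y1)) a2 + inner us (a2 + B *m y2)
  + gamma * eps / 2 * inner (a2 + B *m y2) (a2 + B *m y2)
  + block_energy a2 (u2 - us) y2 y1
  <= block_energy a1 (u1 - us) y1 y0 + gamma / 2 * inner (a2 - a1) (a2 - a1).
Proof.
move=> g0 f0 /andP[e0 e1] hL hy hm -> hQ.
have t0 : 0 < 2 - phi - eps by lra.
have uE (v r : 'cV[R]_p) : (2 * (phi * gamma))^-1 *
    inner (v + (phi * gamma) *: r) (v + (phi * gamma) *: r)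
  = (2 * (phi * gamma))^-1 * inner v v + inner v r + phi * gamma / 2 * inner r r.
  by rewrite !inner_lin (innerC r v); field; rewrite !gt_eqF.
(* Monotonicity trades the new residual in the cross term for [1 - phi] times the old one. Of the
   coefficient [gamma * (2 - phi) / 2] available on the new residual, this weight leaves
   [gamma * eps / 2] as decrease. *)
have young : gamma * (2 * (1 - phi) * inner (a1 + B *m y1) (B *m (y2 - y1)))
   <= gamma * ((2 - phi - eps) * inner (a1 + B *m y1) (a1 + B *m y1)
      + (1 - phi) ^+ 2 / (2 - phi - eps) * inner (B *m (y2 - y1)) (B *m (y2 - y1))).
  rewrite ler_pM2l //; move: (B *m (y2 - y1)) (a1 + _) => s r.
  set t := 2 - phi - eps in t0 *; set f := 1 - phi.
  have : 0 <= t^-1 * inner (t *: r - f *: s) (t *: r - f *: s).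
    by rewrite mulr_ge0 ?inner_ge0 // invr_ge0 ltW.
  have -> : t^-1 * inner (t *: r - f *: s) (t *: r - f *: s)
      = t * inner r r + f ^+ 2 / t * inner s s - 2 * f * inner r s.
    by rewrite !inner_lin (innerC s r); field; rewrite gt_eqF.
  by rewrite subr_ge0.
rewrite /block_energy (addrAC u1) uE.
have := hL (y2 - y1); move: hy hm hQ young.
set k := (1 - phi) ^+ 2 / _.
rewrite !(mulmxBr, inner_trmx, inner_lin).
(* Once symmetric inner products are identified, the claim is a linear combination of the collected
   inequalities. *)
have sym := (innerC a2 a1, innerC (B *m y0) a1, innerC (B *m y1) a1,
  innerC (B *m y2) a1, innerC (B *m y0) a2, innerC (B *m y1) a2,
  innerC (B *m y2) a2, innerC (B *m y1) (B *m y0), innerC (B *m y2) (B *m y0),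
  innerC (B *m y2) (B *m y1), innerC y1 y0, innerC y2 y0, innerC y2 y1,
  innerC us u1).
rewrite !sym.
lra.
Qed.

End BlockDescent.

(** * Exchanging sums over nodes and over cliques *)

Section CliqueSums.
Context {R : realType} {n d : nat}.

Lemma inner_restr (C : {set 'I_n}) (x : 'cV[R]_(\sum_(i < n) d)) :
  inner (restr C x) (restr C x)
  = \sum_(i in C) inner (submxcol x i) (submxcol x i).
Proof.
rewrite inner_mxcol [RHS]big_enum_val; apply: eq_bigr => j _.
by rewrite /restr mxcolK.
Qed.

Lemma restrB (C : {set 'I_n}) (x y : 'cV[R]_(\sum_(i < n) d)) :
  restr C (x - y) = restr C x - restr C y.
Proof. by rewrite -!WlE mulmxBr. Qed.

Lemma sum_inner_blk_at (C : {set 'I_n}) w (x : 'cV[R]_(\sum_(i < n) d)) :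
  \sum_(i in C) inner (blk_at w i) (submxcol x i) = inner w (restr C x).
Proof.
rewrite inner_mxcol [LHS]big_enum_val; apply: eq_bigr => j _.
by rewrite /restr mxcolK /blk_at pos_enum_val.
Qed.

(** The node-wise coupling terms are the blocks of the adjoint of [bigW] applied to [w]. *)
Lemma sum_inner_blk_at_family (Q : {set {set 'I_n}})
    (w : forall l : 'I_#|Q|, 'cV[R]_(\sum_(j < #|cl l|) d)) x :
  \sum_i inner (\sum_(l < #|Q| | i \in cl l) blk_at (w l) i) (submxcol x i)
  = \sum_l inner (w l) (restr (cl l) x).
Proof.
transitivity (\sum_i \sum_(l < #|Q| | i \in cl l) inner (blk_at (w l) i) (submxcol x i)).
  by apply: eq_bigr => i _; rewrite inner_sum.
rewrite (exchange_big_dep xpredT) //=; apply: eq_bigr => l _.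
exact: sum_inner_blk_at.
Qed.

(** Each node is charged once by every clique containing it, so the clique bounds by [lambda_max]
    add up to the node-wise step-size condition. *)
Lemma sum_gram_le (Q : {set {set 'I_n}}) (p : 'I_#|Q| -> nat)
    (A : forall l, 'M[R]_(p l, \sum_(j < #|cl l|) d)) (gamma : 'I_#|Q| -> R)
    (a : 'I_n -> R) x :
    (forall l, 0 < gamma l) ->
    (forall i, \sum_(l < #|Q| | i \in cl l)
       gamma l * lambda_max ((A l)^T *m A l) <= a i) ->
  \sum_l gamma l * inner (A l *m restr (cl l) x) (A l *m restr (cl l) x)
  <= \sum_i a i * inner (submxcol x i) (submxcol x i).
Proof.
move=> gamma_gt0 ha.
pose lam l := gamma l * lambda_max ((A l)^T *m A l).
apply: (@le_trans _ _
    (\sum_l \sum_(i in cl l) lam l * inner (submxcol x i) (submxcol x i))).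
  apply: ler_sum => l _; rewrite -mulr_sumr -inner_restr /lam -mulrA.
  by rewrite ler_pM2l // -inner_gram lambda_maxP //; exact: psd_gram.
rewrite (exchange_big_dep xpredT) //=; apply: ler_sum => i _.
by rewrite -mulr_suml ler_wpM2r ?inner_ge0.
Qed.

End CliqueSums.

(** * Limits from descent and from the Euclidean norm *)

Section Limits.
Context {R : realType}.

(** [V] is nonincreasing and bounded below, so its decrements tend to 0, and they dominate [e]. *)
Lemma cvg0_of_descent (V e : nat -> R) : (forall k, 0 <= V k) ->
  (forall k, 0 <= e k) -> (forall k, e k + V k.+1 <= V k) -> e @ \oo --> (0 : R).
Proof.
move=> V0 e0 desc.
have cV : cvgn V.
  apply: nonincreasing_is_cvgn.
    apply/nonincreasing_seqP => k; apply: le_trans (desc k).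
    by rewrite lerDr.
  by exists 0 => _ [k _ <-].
have d0 : (fun k => V k - V k.+1) @ \oo --> (0 : R).
  rewrite -(subrr (limn V)); apply: cvgB => //.
  by rewrite (cvg_shiftS V).
apply: (squeeze_cvgr _ (cvg_cst 0) d0).
by near=> k; rewrite e0 lerBrDr desc.
Unshelve. all: by end_near.
Qed.

(** The topology is that of the sup norm, which is attained at an entry and hence at most
    [enorm]. *)
Lemma cvg_enorm0 d (r : nat -> 'cV[R]_d) :
  (fun k => enorm (r k)) @ \oo --> (0 : R) -> r @ \oo --> (0 : 'cV[R]_d).
Proof.
move=> /cvgrPdist_lt r0; apply/cvgrPdist_lt => e e0.
near=> k; have : enorm (r k) < e.
  near: k; move: (r0 e e0); apply: filterS => k.
  by rewrite sub0r normrN ger0_norm // enorm_ge0.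
apply: le_lt_trans; rewrite sub0r normrN.
have [->|] := eqVneq `|r k| 0; first exact: enorm_ge0.
move=> /mx_norm_neq0 [[i j]]; rewrite -[mx_norm _]/(`|r k|) => -> /=.
by rewrite -sqrtr_sqr ler_wsqrtr // sqr_le_inner.
Unshelve. all: by end_near.
Qed.

Lemma cvg_inner0 d (r : nat -> 'cV[R]_d) v :
  (fun k => enorm (r k)) @ \oo --> (0 : R) ->
  (fun k => inner v (r k)) @ \oo --> (0 : R).
Proof.
move=> r0.
have b0 : (fun k => enorm v * enorm (r k)) @ \oo --> (0 : R).
  by rewrite -(mulr0 (enorm v)); apply: cvgM => //; exact: cvg_cst.
have nb0 : (fun k => - (enorm v * enorm (r k))) @ \oo --> (0 : R).
  by rewrite -oppr0; apply: cvgN.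
apply: (squeeze_cvgr _ nb0 b0); near=> k.
rewrite cauchy_schwarz andbT lerNl -innerNl.
by apply: le_trans (cauchy_schwarz _ _) _; rewrite /enorm innerNl innerNr opprK.
Unshelve. all: by end_near.
Qed.

End Limits.

(** * Saddle points and the Lagrangian gap *)

Section Saddle.
Context {R : realType} {n d : nat} {Q : {set {set 'I_n}}} {p q : 'I_#|Q| -> nat}.
Context (A : forall l, 'M[R]_(p l, \sum_(j < #|cl l|) d))
        (B : forall l, 'M[R]_(p l, q l)) (c : forall l, 'cV[R]_(p l)).
Context (f : 'I_n -> 'cV[R]_d -> \bar R) (g : forall l, 'cV[R]_(q l) -> \bar R).
Context (xs : 'cV[R]_(\sum_(i < n) d)) (ys : 'cV[R]_(\sum_l q l))
        (us : 'cV[R]_(\sum_l p l)).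
Arguments g : clear implicits.
Hypotheses (f_proper : forall i, proper_fun (f i))
           (g_proper : forall l, proper_fun (g l))
           (saddle : saddle_point A B c f g xs ys us).

(** [fine] sends infinite values to 0, so [Freal] and [Greal] represent the objective only on
    [in_dom]. *)
Definition Freal (x : 'cV[R]_(\sum_(i < n) d)) : R :=
  \sum_i fine (f i (submxcol x i)).
Definition Greal (y : 'cV[R]_(\sum_l q l)) : R :=
  \sum_l fine (g l (submxcol y l)).

Definition in_dom (x : 'cV[R]_(\sum_(i < n) d)) (y : 'cV[R]_(\sum_l q l)) :=
  (forall i, f i (submxcol x i) \is a fin_num) /\
  (forall l, g l (submxcol y l) \is a fin_num).

Lemma in_dom_objE x y : in_dom x y ->
  (bigF f x + bigG g y)%E = (Freal x + Greal y)%:E.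
Proof.
move=> [fx gy]; rewrite EFinD -!sumEFin; congr (_ + _)%E.
  by apply: eq_bigr => i _; rewrite fineK.
by apply: eq_bigr => l _; rewrite fineK.
Qed.

Lemma sume_lty_fin_num m (a : 'I_m -> \bar R) :
  (forall i, a i != -oo%E) -> (\sum_i a i != +oo)%E ->
  forall i, a i \is a fin_num.
Proof.
move=> aNy sy i; rewrite fin_numE aNy /=; apply: contraNneq sy => ai.
by apply/eqP/esum_eqyP => //; exists i; rewrite mem_index_enum.
Qed.

(** Properness supplies a point with finite Lagrangian, which bounds the value at the saddle point,
    and excludes [-oo]; hence no summand there is [+oo]. *)
Lemma saddle_in_dom : in_dom xs ys.
Proof.
have fin (V : Type) (h : V -> \bar R) z :
    (forall z, h z <> -oo%E) -> h z <> +oo%E -> h z \is a fin_num.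
  by move=> /(_ z)/eqP h1 /eqP h2; rewrite fin_numE h1 h2.
have /fin_all_exists [x0 hx0] : forall i, exists z, f i z \is a fin_num.
  by move=> i; have [h [z hz]] := f_proper i; exists z; exact: fin.
have /fin_all_exists [y0 hy0] : forall l, exists z, g l z \is a fin_num.
  by move=> l; have [h [z hz]] := g_proper l; exists z; exact: fin.
have dom0 : in_dom (\mxcol_i x0 i) (\mxcol_l y0 l).
  by split=> [i|l]; rewrite mxcolK.
have fNy i : f i (submxcol xs i) != -oo%E by apply/eqP; have [h _] := f_proper i.
have gNy l : g l (submxcol ys l) != -oo%E by apply/eqP; have [h _] := g_proper l.
have FNy : bigF f xs != -oo%E.
  by apply/eqP => /esum_eqNyP [i [_ _ /eqP]]; rewrite (negPf (fNy i)).
have GNy : bigG g ys != -oo%E.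
  by apply/eqP => /esum_eqNyP [l [_ _ /eqP]]; rewrite (negPf (gNy l)).
have := saddle.1 (\mxcol_i x0 i) (\mxcol_l y0 l).
rewrite /Lagrangian (in_dom_objE dom0) -EFinD => Ly.
split; apply: sume_lty_fin_num => //; apply/eqP => oo; move: Ly.
  by rewrite /bigF oo !addye // leye_eq.
by rewrite /bigG oo addey // addye // leye_eq.
Qed.

(** Maximality in the multiplier, tested at [us] plus the residual, makes the squared norm of the
    residual nonpositive. *)
Lemma saddle_residual : residual A B c xs ys = 0.
Proof.
apply: inner_eq0; apply/eqP; rewrite eq_le inner_ge0 andbT.
have := saddle.2 (us + residual A B c xs ys).
rewrite /Lagrangian in_dom_objE; last exact: saddle_in_dom.
by rewrite -!EFinD lee_fin innerDl; lra.
Qed.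

(** On [in_dom], the Lagrangian at [us] minus its saddle value, where the residual term vanishes. *)
Definition gap x y : R :=
  Freal x + Greal y - (Freal xs + Greal ys) + inner us (residual A B c x y).

Lemma gap_ge0 x y : in_dom x y -> 0 <= gap x y.
Proof.
move=> dom; have := saddle.1 x y.
rewrite /Lagrangian !in_dom_objE //; last exact: saddle_in_dom.
by rewrite saddle_residual inner0r -!EFinD lee_fin /gap; lra.
Qed.

Lemma residual_lE x y l : residual_l A B c l x y
  = A l *m restr (cl l) (x - xs) + B l *m submxcol (y - ys) l.
Proof.
have := congr1 (fun r => submxcol r l) saddle_residual.
rewrite residualE submxcol0 /residual_l restrB submxcolB !mulmxBr => /eqP.
rewrite subr_eq0 => /eqP <-; apply/matrixP => i j; rewrite !mxE; ring.
Qed.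

End Saddle.

(** * Energy decrease along the iterates, and convergence *)

Section Convergence.
Context {R : realType} {n d : nat} {Q : {set {set 'I_n}}} {p q : 'I_#|Q| -> nat}.
Context (A : forall l, 'M[R]_(p l, \sum_(j < #|cl l|) d))
        (B : forall l, 'M[R]_(p l, q l)) (c : forall l, 'cV[R]_(p l)).
Context (f f1 : 'I_n -> 'cV[R]_d -> \bar R) (f2 : 'I_n -> 'cV[R]_d -> R)
        (Lf : 'I_n -> R).
Context (g g1 : forall l, 'cV[R]_(q l) -> \bar R)
        (g2 : forall l, 'cV[R]_(q l) -> R) (Lg : 'I_#|Q| -> R).
Arguments g : clear implicits.
Arguments g1 : clear implicits.
Arguments g2 : clear implicits.
Context (alpha : 'I_n -> R) (beta gamma phi eps : 'I_#|Q| -> R).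
Context (x : nat -> 'cV[R]_(\sum_(i < n) d)) (y : nat -> 'cV[R]_(\sum_l q l))
        (u : nat -> 'cV[R]_(\sum_l p l)).
Context (xs : 'cV[R]_(\sum_(i < n) d)) (ys : 'cV[R]_(\sum_l q l))
        (us : 'cV[R]_(\sum_l p l)).
Hypotheses
  (alpha_gt0 : forall i, 0 < alpha i) (beta_gt0 : forall l, 0 < beta l)
  (gamma_gt0 : forall l, 0 < gamma l) (phi_gt0 : forall l, 0 < phi l)
  (f_proper : forall i, proper_fun (f i)) (g_proper : forall l, proper_fun (g l))
  (f_split : forall i z, f i z = (f1 i z + (f2 i z)%:E)%E)
  (g_split : forall l z, g l z = (g1 l z + (g2 l z)%:E)%E)
  (f1_ccp : forall i, CCP (f1 i)) (g1_ccp : forall l, CCP (g1 l))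
  (f2_smooth : forall i, convex_smooth (Lf i) (f2 i))
  (g2_smooth : forall l, convex_smooth (Lg l) (g2 l))
  (Lf_ge0 : forall i, 0 <= Lf i) (Lg_ge0 : forall l, 0 <= Lg l)
  (generated : CL_FLiP_ADMM A B c alpha beta gamma phi f1 f2 g1 g2 x y u)
  (saddle : saddle_point A B c f g xs ys us)
  (eps_range : forall l, 0 < eps l < 2 - phi l)
  (alpha_cond : forall i,
    \sum_(l < #|Q| | i \in cl l) gamma l * lambda_max ((A l)^T *m A l) + Lf i
    <= (alpha i)^-1)
  (beta_cond : forall l,
    0 <= (beta l)^-1 - gamma l * lambda_max ((B l)^T *m B l))
  (Lg_cond : forall l,
    loewner_ge
      ((gamma l * (1 - (1 - phi l) ^+ 2 / (2 - phi l - eps l)))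
         *: ((B l)^T *m B l)
       + ((beta l)^-1 *: 1%:M - gamma l *: ((B l)^T *m B l)))
      ((3 * Lg l) *: 1%:M)).

Arguments g_split : clear implicits.

(** These four are errors relative to the saddle point, so that [c] drops out of the residual. *)
Let Ax k l := A l *m restr (cl l) (x k - xs).
Let By k l := B l *m submxcol (y k - ys) l.
Let X k i := submxcol (x k - xs) i.
Let Y k l := submxcol (y k - ys) l.

(* [energy k] involves the iterates k and k + 1: the decrease compares two
   consecutive y-steps, so it starts only at the second one. *)
Definition energy k : R :=
  \sum_l block_energy (B l) (beta l) (gamma l) (phi l) (eps l) (Lg l)
    (Ax k.+1 l) (submxcol (u k.+1) l - submxcol us l) (Y k.+1 l) (Y k l)
  + \sum_i (alpha i)^-1 / 2 * inner (X k.+1 i) (X k.+1 i).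

Let residual_l_split l k j : residual_l A B c l (x k) (y j) = Ax k l + By j l.
Proof. exact: residual_lE f_proper g_proper saddle _ _ _. Qed.

Lemma Lg_cond_inner l z : 3 * Lg l * inner z z <=
  gamma l * (1 - (1 - phi l) ^+ 2 / (2 - phi l - eps l)) * inner (B l *m z) (B l *m z)
  + ((beta l)^-1 * inner z z - gamma l * inner (B l *m z) (B l *m z)).
Proof.
have [_ /(_ z)] := Lg_cond l.
rewrite !(mulmxBl, mulmxDl) -!scalemxAl mul1mx !(innerDr, innerNr, innerZr).
by rewrite inner_gram subr_ge0.
Qed.

Lemma beta_cond_inner l z :
  0 <= (beta l)^-1 * inner z z - gamma l * inner (B l *m z) (B l *m z).
Proof.
have := lambda_maxP z (psd_gram (B l)); rewrite inner_gram.
move=> /(ler_wpM2l (ltW (gamma_gt0 l))) h.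
by have := mulr_ge0 (beta_cond l) (inner_ge0 z); lra.
Qed.

Lemma alpha_cond_inner z :
  \sum_l gamma l * inner (A l *m restr (cl l) z) (A l *m restr (cl l) z)
  <= \sum_i ((alpha i)^-1 - Lf i) * inner (submxcol z i) (submxcol z i).
Proof. by apply: sum_gram_le => // i; rewrite lerBrDr. Qed.

(** Stated from index 1 on: the arbitrary initial point may have infinite objective, a prox point
    may not. *)
Lemma iterate_in_dom k : in_dom f g (x k.+1) (y k.+1).
Proof.
have [hx hy _] := generated k; split=> [i|l].
  by have [] := prox_grad_ineq (f_split i) (f1_ccp i) (f2_smooth i) (alpha_gt0 i) (hx i).
have := hy l; rewrite -(addrA (grad _ _)) => hyl.
by have [] := prox_grad_ineq (g_split l) (g1_ccp l) (g2_smooth l) (beta_gt0 l) hyl.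
Qed.

(** [prox_grad_ineq] at [xs], summed over the nodes; expanding [<X1 - X0, X1>] yields the
    telescoping squares. *)
Lemma x_step k :
  Freal f (x k.+1) - Freal f xs
  + \sum_l (inner (submxcol (u k) l + gamma l *: (Ax k l + By k l)) (Ax k.+1 l)
            + gamma l / 2 * inner (Ax k.+1 l - Ax k l) (Ax k.+1 l - Ax k l))
  + \sum_i (alpha i)^-1 / 2 * inner (X k.+1 i) (X k.+1 i)
  <= \sum_i (alpha i)^-1 / 2 * inner (X k i) (X k i).
Proof.
have [hx _ _] := generated k.
pose w l := (A l)^T *m submxcol (u k) l
  + gamma l *: ((A l)^T *m residual_l A B c l (x k) (y k)).
have step i : fine (f i (submxcol (x k.+1) i))
    + inner (\sum_(l < #|Q| | i \in cl l) blk_at (w l) i) (X k.+1 i)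
    + ((alpha i)^-1 / 2 * inner (X k.+1 i) (X k.+1 i)
       - (alpha i)^-1 / 2 * inner (X k i) (X k i)
       + ((alpha i)^-1 - Lf i) / 2 * inner (X k.+1 i - X k i) (X k.+1 i - X k i))
    <= fine (f i (submxcol xs i)).
  have [fxs _] := saddle_in_dom f_proper g_proper saddle.
  have [_ /(_ _ (fxs i))] := prox_grad_ineq (f_split i) (f1_ccp i) (f2_smooth i)
    (alpha_gt0 i) (hx i).
  have -> : submxcol (x k.+1) i - submxcol (x k) i = X k.+1 i - X k i.
    by rewrite /X !submxcolB opprB addrA subrK.
  have -> : submxcol (x k.+1) i - submxcol xs i = X k.+1 i by rewrite /X submxcolB.
  rewrite -/w; move: (X k.+1 i) (X k i) (bigop _ _ _) => X1 X0 v.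
  by rewrite !inner_lin (innerC X0 X1); lra.
have wE : \sum_i inner (\sum_(l < #|Q| | i \in cl l) blk_at (w l) i) (X k.+1 i)
    = \sum_l inner (submxcol (u k) l + gamma l *: (Ax k l + By k l)) (Ax k.+1 l).
  rewrite sum_inner_blk_at_family; apply: eq_bigr => l _.
  by rewrite /w scalemxAr -mulmxDr inner_trmx residual_l_split.
(* The step-size condition lets the leftover squares of the x-increment pay for the coupling
   [gamma / 2] terms. *)
have quad : \sum_l gamma l / 2 * inner (Ax k.+1 l - Ax k l) (Ax k.+1 l - Ax k l)
    <= \sum_i ((alpha i)^-1 - Lf i) / 2 * inner (X k.+1 i - X k i) (X k.+1 i - X k i).
  have := alpha_cond_inner (x k.+1 - x k).
  rewrite -(ler_pM2l (_ : 0 < 2^-1)) // !mulr_sumr.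
  have -> : x k.+1 - x k = (x k.+1 - xs) - (x k - xs) by rewrite opprB addrA subrK.
  under eq_bigr do rewrite restrB mulmxBr.
  under [in X in _ <= X]eq_bigr do rewrite submxcolB.
  move=> h; apply: le_trans (le_trans h _); rewrite le_eqVlt; apply/orP; left.
    by apply/eqP; apply: eq_bigr => l _; rewrite -/(Ax _ _); ring.
  by apply/eqP; apply: eq_bigr => i _; rewrite -/(X _ _); ring.
have {step} := ler_sum (index_enum _) (fun i (_ : xpredT i) => step i).
by rewrite !big_split /= sumrN wE /Freal; lra.
Qed.

Lemma y_step k l :
  fine (g l (submxcol (y k.+2) l)) - fine (g l (submxcol ys l))
  - inner (submxcol (u k.+1) l + gamma l *: (Ax k.+1 l + By k.+1 l)) (Ax k.+2 l)
  + inner (submxcol us l) (Ax k.+2 l + By k.+2 l)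
  + gamma l * eps l / 2 * inner (Ax k.+2 l + By k.+2 l) (Ax k.+2 l + By k.+2 l)
  + block_energy (B l) (beta l) (gamma l) (phi l) (eps l) (Lg l)
      (Ax k.+2 l) (submxcol (u k.+2) l - submxcol us l) (Y k.+2 l) (Y k.+1 l)
  <= block_energy (B l) (beta l) (gamma l) (phi l) (eps l) (Lg l)
      (Ax k.+1 l) (submxcol (u k.+1) l - submxcol us l) (Y k.+1 l) (Y k l)
     + gamma l / 2 * inner (Ax k.+2 l - Ax k.+1 l) (Ax k.+2 l - Ax k.+1 l).
Proof.
have dY j : submxcol (y j.+1) l - submxcol (y j) l = Y j.+1 l - Y j l.
  by rewrite /Y !submxcolB opprB addrA subrK.
have [_ /(_ l) prox1 /(_ l) u1E] := generated k.
have [_ /(_ l) prox2 /(_ l) u2E] := generated k.+1.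
rewrite -(addrA (grad _ _)) residual_l_split in prox1.
rewrite -(addrA (grad _ _)) residual_l_split in prox2.
rewrite residual_l_split in u1E; rewrite residual_l_split in u2E.
have [_ gys] := saddle_in_dom f_proper g_proper saddle.
apply: block_descent => //.
- exact: Lg_cond_inner.
- have [_ /(_ _ (gys l))] := prox_grad_ineq (g_split l) (g1_ccp l) (g2_smooth l)
    (beta_gt0 l) prox2.
  have -> : submxcol (y k.+2) l - submxcol ys l = Y k.+2 l by rewrite /Y submxcolB.
  by rewrite dY; lra.
- have := prox_grad_monotone (g1_ccp l) (g2_smooth l) (Lg_ge0 l) (beta_gt0 l) prox1 prox2.
  rewrite !dY u1E (mulmxDr _ (submxcol (u k) l)) -/(By _ _).
  (* [P] is the old multiplier term: [u1E] leaves only its increment [N]. *)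
  have shift (P N C C' : 'cV[R]_(q l)) : P + N + C - (P + C') = N + C - C'.
    by apply/matrixP => i j; rewrite !mxE; ring.
  by rewrite shift.
- exact: beta_cond_inner.
Qed.

(** Adding [x_step] and the sum of [y_step] cancels the terms in [Ax k.+2] and its increment; the
    terms in [us] complete the gap. *)
Lemma energy_decrease k :
  gap A B c f g xs ys us (x k.+2) (y k.+2)
  + \sum_l gamma l * eps l / 2 *
      inner (residual_l A B c l (x k.+2) (y k.+2)) (residual_l A B c l (x k.+2) (y k.+2))
  + energy k.+1 <= energy k.
Proof.
have := x_step k.+1.
have := ler_sum (index_enum _) (fun l (_ : xpredT l) => y_step k l).
have usE : inner us (residual A B c (x k.+2) (y k.+2))
    = \sum_l inner (submxcol us l) (Ax k.+2 l + By k.+2 l).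
  by rewrite inner_mxcol; apply: eq_bigr => l _; rewrite residualE residual_l_split.
under [in X in _ -> _ -> X]eq_bigr do rewrite residual_l_split.
by rewrite /gap usE /energy /Greal !big_split /= !sumrN; lra.
Qed.

(** The terms [- gamma / 2 |a|^2] are compensated by the [alpha] squares, and the negative [B] term
    by [beta_cond]. *)
Lemma energy_ge0 k : 0 <= energy k.
Proof.
have block_ge l a v (z z' : 'cV[R]_(q l)) : - (gamma l / 2 * inner a a)
    <= block_energy (B l) (beta l) (gamma l) (phi l) (eps l) (Lg l) a v z z'.
  have /andP[e0 e1] := eps_range l; have t0 : 0 < 2 - phi l - eps l by lra.
  have bV : 0 < (beta l)^-1 by rewrite invr_gt0.
  have pgV : 0 < (2 * (phi l * gamma l))^-1 by rewrite invr_gt0 !mulr_gt0.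
  have := mulr_ge0 (ltW bV) (inner_ge0 z).
  have := mulr_ge0 (ltW pgV) (inner_ge0 v).
  have := mulr_ge0 (ltW (mulr_gt0 (gamma_gt0 l) t0)) (inner_ge0 (a + B l *m z)).
  have := beta_cond_inner (z - z').
  have := mulr_ge0 (Lg_ge0 l) (inner_ge0 (z - z')).
  by rewrite /block_energy; lra.
have : - (\sum_l gamma l / 2 * inner (Ax k.+1 l) (Ax k.+1 l)) <=
    \sum_l block_energy (B l) (beta l) (gamma l) (phi l) (eps l) (Lg l)
    (Ax k.+1 l) (submxcol (u k.+1) l - submxcol us l) (Y k.+1 l) (Y k l).
  by rewrite -sumrN; apply: ler_sum => l _; exact: block_ge.
have := alpha_cond_inner (x k.+1 - xs).
have : \sum_i ((alpha i)^-1 - Lf i) * inner (X k.+1 i) (X k.+1 i)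
    <= \sum_i (alpha i)^-1 * inner (X k.+1 i) (X k.+1 i).
  by apply: ler_sum => i _; rewrite ler_wpM2r ?inner_ge0 // gerBl.
rewrite /energy.
have half m (a s : 'I_m -> R) : \sum_i a i / 2 * s i = 2^-1 * \sum_i a i * s i.
  by rewrite mulr_sumr; apply: eq_bigr => i _; ring.
by rewrite !half /Ax /X; lra.
Qed.

Lemma flip_admm_cvg :
  ((fun k => bigF f (x k) + bigG g (y k))%E @ \oo --> (bigF f xs + bigG g ys)%E)
  /\ ((fun k => residual A B c (x k) (y k)) @ \oo --> (0 : 'cV[R]_(\sum_l p l))).
Proof.
pose sq k l := inner (residual_l A B c l (x k.+2) (y k.+2))
                     (residual_l A B c l (x k.+2) (y k.+2)).
pose gp k := gap A B c f g xs ys us (x k.+2) (y k.+2).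
have gp_ge0 k : 0 <= gp k.
  by apply: gap_ge0 => //; exact: iterate_in_dom.
have ge_gt0 l : 0 < gamma l * eps l / 2.
  by rewrite divr_gt0 // mulr_gt0 //; have /andP[] := eps_range l.
have term_ge0 k l : 0 <= gamma l * eps l / 2 * sq k l.
  by rewrite mulr_ge0 ?inner_ge0 // ltW.
have e_ge0 k : 0 <= gp k + \sum_l gamma l * eps l / 2 * sq k l.
  by rewrite addr_ge0 // sumr_ge0.
have e0 := cvg0_of_descent energy_ge0 e_ge0 energy_decrease.
set e := (fun k => _) in e0.
have gp0 : gp @ \oo --> (0 : R).
  apply: (squeeze_cvgr _ (cvg_cst 0) e0); near=> k.
  by rewrite gp_ge0 /e lerDl sumr_ge0.
(* Each squared residual block is at most [e k] divided by its weight, so [K * e k] bounds the whole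
   squared norm. *)
pose K := \sum_l (gamma l * eps l / 2)^-1.
have r0 : (fun k => enorm (residual A B c (x k.+2) (y k.+2))) @ \oo --> (0 : R).
  have Ke0 : (fun k => Num.sqrt (K * e k)) @ \oo --> (0 : R).
    rewrite -[X in _ --> X]sqrtr0 -(mulr0 K).
    apply: (@cvg_comp _ _ _ (fun k => K * e k) Num.sqrt);
      last exact: sqrt_continuous.
    by apply: cvgM e0; exact: cvg_cst.
  apply: (squeeze_cvgr _ (cvg_cst 0) Ke0); near=> k.
  rewrite enorm_ge0 /enorm ler_wsqrtr // inner_mxcol /K mulr_suml.
  apply: ler_sum => l _; rewrite residualE mulrC ler_pdivlMr // mulrC.
  rewrite -/(sq k l) /e (bigD1 l) //= addrCA lerDl addr_ge0 //.
  by apply: sumr_ge0 => *.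
split.
  (* The energy decrease controls the iterates from index 2 on, where the objective is also
     finite. *)
  rewrite -(cvg_shiftn 2) (in_dom_objE (saddle_in_dom f_proper g_proper saddle)).
  have -> : (fun k => bigF f (x (k + 2)%N) + bigG g (y (k + 2)%N))%E
      = (fun k => (gp k - inner us (residual A B c (x k.+2) (y k.+2))
                   + (Freal f xs + Greal g ys))%:E).
    apply/funext => k; rewrite addn2 (in_dom_objE (iterate_in_dom k.+1)) /gp /gap.
    by congr (_%:E); ring.
  apply: cvg_EFin; first by near=> k.
  have := cvgB gp0 (cvg_inner0 us r0); rewrite subrr => /(_ _) lim0.
  rewrite -[X in _ --> X]add0r; apply: cvgD; [exact: lim0|exact: cvg_cst].
rewrite -(cvg_shiftn 2).
have -> : (fun k => residual A B c (x (k + 2)%N) (y (k + 2)%N))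
  = (fun k => residual A B c (x k.+2) (y k.+2)) by apply/funext => k; rewrite addn2.
exact: cvg_enorm0.
Unshelve. all: by end_near.
Qed.

End Convergence.

Theorem theorem1 (R : realType) (n d : nat)
  (e : rel 'I_n) (e_sym : symmetric e)
  (Q : {set {set 'I_n}}) (Q_cliques : Q \subset cliques e)
  (p q : 'I_#|Q| -> nat)
  (A : forall l, 'M[R]_(p l, \sum_(j < #|cl l|) d))
  (B : forall l, 'M[R]_(p l, q l)) (c : forall l, 'cV[R]_(p l))
  (f f1 : 'I_n -> 'cV[R]_d -> \bar R) (f2 : 'I_n -> 'cV[R]_d -> R)
  (Lf : 'I_n -> R)
  (g g1 : forall l, 'cV[R]_(q l) -> \bar R) (g2 : forall l, 'cV[R]_(q l) -> R)
  (Lg : 'I_#|Q| -> R)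
  (alpha : 'I_n -> R) (beta gamma phi eps : 'I_#|Q| -> R)
  (x : nat -> 'cV[R]_(\sum_(i < n) d)) (y : nat -> 'cV[R]_(\sum_l q l))
  (u : nat -> 'cV[R]_(\sum_l p l))
  (xs : 'cV[R]_(\sum_(i < n) d)) (ys : 'cV[R]_(\sum_l q l))
  (us : 'cV[R]_(\sum_l p l))
  (alpha_gt0 : forall i, 0 < alpha i)
  (beta_gt0 : forall l, 0 < beta l)
  (gamma_gt0 : forall l, 0 < gamma l)
  (phi_gt0 : forall l, 0 < phi l)
  (f_ccp : forall i, CCP (f i))
  (f_split : forall i z, f i z = (f1 i z + (f2 i z)%:E)%E)
  (f1_ccp : forall i, CCP (f1 i))
  (Lf_ge0 : forall i, 0 <= Lf i)
  (f2_smooth : forall i, convex_smooth (Lf i) (f2 i))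
  (g_ccp : forall l, CCP (g l))
  (g_split : forall l z, g l z = (g1 l z + (g2 l z)%:E)%E)
  (g1_ccp : forall l, CCP (g1 l))
  (Lg_ge0 : forall l, 0 <= Lg l)
  (g2_smooth : forall l, convex_smooth (Lg l) (g2 l))
  (generated :
    CL_FLiP_ADMM A B c alpha beta gamma phi f1 f2 g1 g2 x y u \/
    [/\ forall i, [/\ f1 i = f i, forall z, f2 i z = 0 & Lf i = 0],
        forall l, [/\ g1 l = g l, forall z, g2 l z = 0 & Lg l = 0] &
        CL_ADMM A B c alpha beta gamma phi f g x y u])
  (saddle : saddle_point A B c f g xs ys us)
  (eps_range : forall l, 0 < eps l < 2 - phi l)
  (alpha_cond : forall i,
    \sum_(l < #|Q| | i \in cl l) gamma l * lambda_max ((A l)^T *m A l) + Lf i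
    <= (alpha i)^-1)
  (beta_cond : forall l,
    0 <= (beta l)^-1 - gamma l * lambda_max ((B l)^T *m B l))
  (Lg_cond : forall l,
    loewner_ge
      ((gamma l * (1 - (1 - phi l) ^+ 2 / (2 - phi l - eps l)))
         *: ((B l)^T *m B l)
       + ((beta l)^-1 *: 1%:M - gamma l *: ((B l)^T *m B l)))
      ((3 * Lg l) *: 1%:M)) :
  ((fun k => bigF f (x k) + bigG g (y k))%E @ \oo --> (bigF f xs + bigG g ys)%E)
  /\ ((fun k => residual A B c (x k) (y k)) @ \oo --> (0 : 'cV[R]_(\sum_l p l))).
Proof.
have grad0 m (h : 'cV[R]_m -> R^o) z : (forall z, h z = 0) -> grad h z = 0.
  move=> h0; apply/matrixP => i j; rewrite !mxE (_ : h = cst 0) ?derive_cst //.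
  exact/funext.
have f_proper i : proper_fun (f i) by have [] := f_ccp i.
have g_proper l : proper_fun (g l) by have [] := g_ccp l.
(* With zero smooth parts the gradients vanish, so a CL-ADMM run is a CL-FLiP-ADMM run. *)
have {}generated : CL_FLiP_ADMM A B c alpha beta gamma phi f1 f2 g1 g2 x y u.
  case: generated => // -[f10 g10 gen] k; have [hx hy hu] := gen k.
  split=> // [i|l].
    by have [-> f20 _] := f10 i; rewrite grad0 // add0r.
  by have [-> g20 _] := g10 l; rewrite grad0 // add0r.
exact: (flip_admm_cvg alpha_gt0 beta_gt0 gamma_gt0 phi_gt0 f_proper g_proper
  f_split g_split f1_ccp g1_ccp f2_smooth g2_smooth Lf_ge0 Lg_ge0 generated
  saddle eps_range alpha_cond beta_cond Lg_cond).
Qed.
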